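(* Let $\mathbf{k}$ be a commutative ring, let $k\in\mathbb{N}$, and let $n\geq k$ be an integer. Let $\mathcal{P}=\mathbf{k}[x_1,x_2,\ldots,x_k]$. For each $i\in\{1,2,\ldots,k\}$, let $a_i\in\mathcal{P}$ be a (not necessarily homogeneous) polynomial of degree $<n-k+i$. Let $J$ be the ideal of $\mathcal{P}$ generated by the $k$ differences $h_{n-k+1}-a_1,\ h_{n-k+2}-a_2,\ \ldots,\ h_n-a_k$. Then the $\mathbf{k}$-module $\mathcal{P}/J$ is free with basis $\left(\overline{x^\alpha}\right)_{\alpha\in\mathbb{N}^k;\ \alpha_i<n-k+i\text{ for each }i}$, where $\overline{x^\alpha}$ denotes the residue class of $x^\alpha$ modulo $J$.
   Context: $\mathbb{N}=\{0,1,2,\ldots\}$. The degree of a polynomial is its total degree (each $x_i$ has degree $1$); the zero polynomial counts as having degree smaller than every integer. For $\alpha=(\alpha_1,\ldots,\alpha_k)\in\mathbb{N}^k$, $x^\alpha=x_1^{\alpha_1}x_2^{\alpha_2}\cdots x_k^{\alpha_k}$ and $|\alpha|=\alpha_1+\cdots+\alpha_k$. For $m\in\mathbb{Z}$, $h_m=\sum_{\alpha\in\mathbb{N}^k,\ |\alpha|=m}x^\alpha\in\mathcal{P}$ is the $m$-th complete homogeneous symmetric polynomial in $x_1,\ldots,x_k$ (so $h_0=1$ and $h_m=0$ for $m<0$). *)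

(* Defs.v *)
From HB Require Import structures.
From mathcomp Require Import all_boot all_algebra.
From mathcomp Require Import boolp.
From mathcomp.multinomials Require Import mpoly.

Set Implicit Arguments.
Unset Strict Implicit.
Unset Printing Implicit Defensive.

Import GRing.Theory.
Local Open Scope ring_scope.
Local Open Scope quotient_scope.

Section GeneratedIdeal.
Variables (R : comNzRingType) (A : comAlgType R) (m : nat) (g : 'I_m -> A).

Definition gen_ideal : {pred A} :=
  fun p => `[< exists c : 'I_m -> A, p = \sum_(i < m) c i * g i >].

Lemma gen_idealP p :
  reflect (exists c : 'I_m -> A, p = \sum_(i < m) c i * g i)
          (p \in gen_ideal).
Proof. exact: asboolP. Qed.

Lemma gen_ideal_submod_closed : submod_closed gen_ideal.
Proof.
split=> [|a p q /gen_idealP[c ->] /gen_idealP[d ->]]; apply/gen_idealP.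
  by exists (fun=> 0); rewrite big1 // => i _; rewrite mul0r.
exists (fun i => a *: c i + d i); rewrite scaler_sumr -big_split /=.
by apply: eq_bigr => i _; rewrite mulrDl scalerAl.
Qed.

HB.instance Definition _ :=
  GRing.isZmodClosed.Build A gen_ideal
    (GRing.submod_closedB gen_ideal_submod_closed).

Lemma gen_ideal_scale c p : p \in gen_ideal -> c *: p \in gen_ideal.
Proof.
move=> pI; have [I0 IZ] := gen_ideal_submod_closed.
by rewrite -[_ *: _]addr0; exact: IZ.
Qed.

(* ring_quotient makes this a ring only when the ideal is proper; as a
   Z-module it needs no such assumption, and the scalars of R act on it. *)
Definition gen_quot := Quotient.quot gen_ideal.

HB.instance Definition _ := GRing.Zmodule.on gen_quot.

Definition residue (p : A) : gen_quot := \pi_(Quotient.quot gen_ideal) p.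

Lemma residue_surj (x : gen_quot) : {p | residue p = x}.
Proof. by exists (repr x); exact: reprK. Qed.

Lemma residue_eqP p q : reflect (residue p = residue q) (p - q \in gen_ideal).
Proof. by rewrite Quotient.idealrBE; exact: eqP. Qed.

Lemma residue_is_zmod_morphism : zmod_morphism residue.
Proof. exact: raddfB. Qed.

HB.instance Definition _ :=
  GRing.isZmodMorphism.Build A gen_quot residue residue_is_zmod_morphism.

Definition quot_scale (c : R) (x : gen_quot) : gen_quot :=
  residue (c *: repr x).

Lemma residueZ c p : residue (c *: p) = quot_scale c (residue p).
Proof.
apply/residue_eqP; rewrite -scalerBr; apply: gen_ideal_scale.
by apply/residue_eqP; rewrite [RHS]reprK.
Qed.

Lemma quot_scaleA a b x : quot_scale a (quot_scale b x) = quot_scale (a * b) x.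
Proof. by have [p <-] := residue_surj x; rewrite -!residueZ scalerA. Qed.

Lemma quot_scale1 : left_id 1 quot_scale.
Proof. by move=> x; have [p <-] := residue_surj x; rewrite -residueZ scale1r. Qed.

Lemma quot_scaleDr : right_distributive quot_scale +%R.
Proof.
move=> c x y; have [p <-] := residue_surj x; have [q <-] := residue_surj y.
by rewrite -raddfD -!residueZ -raddfD -scalerDr.
Qed.

Lemma quot_scaleDl x : {morph quot_scale^~ x : a b / a + b}.
Proof.
by move=> a b; have [p <-] := residue_surj x; rewrite -!residueZ -raddfD -scalerDl.
Qed.

HB.instance Definition _ :=
  GRing.Zmodule_isLmodule.Build R gen_quot
    quot_scaleA quot_scale1 quot_scaleDr quot_scaleDl.

HB.instance Definition _ :=
  GRing.isScalable.Build R A gen_quot *:%R residue residueZ.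

End GeneratedIdeal.

(* I may be infinite: linear combinations range over finite sequences of
   indices. *)
Section Basis.
Variables (R : pzRingType) (V : lmodType R) (I : eqType) (v : I -> V).

Definition lin_indep : Prop :=
  forall (s : seq I) (c : I -> R), uniq s ->
    \sum_(i <- s) c i *: v i = 0 -> {in s, forall i, c i = 0}.

Definition spanning : Prop :=
  forall x : V, exists (s : seq I) (c : I -> R), x = \sum_(i <- s) c i *: v i.

Definition is_basis : Prop := lin_indep /\ spanning.

End Basis.

(* 'X_{1..k < m.+1} is the finite type of exponents of degree <= m. *)
Definition hsym (R : comNzRingType) (k m : nat) : {mpoly R[k]} :=
  \sum_(al : 'X_{1..k < m.+1} | mdeg al == m) 'X_[al].

(* 'I_k is 0-based: the bound n - k + i for i in {1..k} becomes n - k + i.+1. *)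
Definition box (k n : nat) : eqType :=
  {al : 'X_{1..k} | [forall i : 'I_k, (al i < n - k + i.+1)%N]}.

(* Main.v *)
(** As h_m(x_i, ..., x_k) - x_i h_{m-1}(x_i, ..., x_k) = h_m(x_{i+1}, ..., x_k),
    a unitriangular change of generators replaces h_{n-k+i} - a_i by some f_i
    whose top homogeneous part is h_{n-k+i}(x_i, ..., x_k).  For the
    degree-lexicographic order, f_i is therefore monic with leading monomial
    x_i^{D_i}, D_i = n-k+i.  By Euclidean division of the exponents by the D_i,
    the products x^r f^q with r_i < D_i have every monomial as leading monomial
    exactly once, hence form a basis of the polynomial ring; those with q <> 0
    span J, and those with q = 0 give the basis of the quotient. *)

From HB Require Import structures.
Require Import Defs.
From mathcomp Require Import all_boot all_order all_algebra.
From mathcomp.multinomials Require Import ssrcomplements mpoly.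

Set Implicit Arguments.
Unset Strict Implicit.
Unset Printing Implicit Defensive.

Import Order.TTheory GRing.Theory.
Local Open Scope ring_scope.

(** * Finitely generated ideals *)

Section IdealClosure.
Context {R : comNzRingType} {A : comAlgType R} {m : nat}.
Implicit Types (g f : 'I_m -> A) (p q : A).

Lemma gen_idealMl g p q : q \in gen_ideal g -> p * q \in gen_ideal g.
Proof.
move=> /gen_idealP[c ->]; apply/gen_idealP; exists (fun i => p * c i).
by rewrite mulr_sumr; apply: eq_bigr => i _; rewrite mulrA.
Qed.

Lemma mem_gen_ideal g i : g i \in gen_ideal g.
Proof.
apply/gen_idealP; exists (fun j => (j == i)%:R).
rewrite (bigD1 i) //= eqxx mul1r big1 ?addr0 // => j /negbTE->.
by rewrite mul0r.
Qed.

Lemma gen_ideal_sub g f :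
  (forall i, g i \in gen_ideal f) -> {subset gen_ideal g <= gen_ideal f}.
Proof.
move=> gf p /gen_idealP[c ->]; apply: rpred_sum => i _.
exact: gen_idealMl.
Qed.

End IdealClosure.

(** * Coefficients and leading monomials *)

Section Coefficients.
Context {k : nat} {R : comNzRingType}.
Implicit Types (p : {mpoly R[k]}) (m : 'X_{1..k}).

Lemma mcoeffXM_not_le m m' p i : (m i < m' i)%N -> ('X_[m'] * p)@_m = 0.
Proof.
move=> lt_mm'; elim/mpolyind: p => [|c m1 p _ _ IHp].
  by rewrite mulr0 mcoeff0.
rewrite mulrDr mcoeffD IHp addr0 -scalerAr mcoeffZ -mpolyXD mcoeffX.
case: eqP => [eq_m|]; last by rewrite mulr0.
by move: lt_mm'; rewrite -eq_m mnmDE -ltn_subRL subnn.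
Qed.

Lemma mcoeffXUM (i : 'I_k) p m :
  ('X_i * p)@_m = if (0 < m i)%N then p@_(m - U_(i)) else 0.
Proof.
case: ifP => [m_gt0|/negbT]; last first.
  rewrite -leqNgt => m_le0.
  by rewrite (@mcoeffXM_not_le _ _ _ i) // mnm1E eqxx.
have le_Um : (U_(i) <= m)%MM.
  by apply/mnm_lepP => j; rewrite mnm1E; case: eqVneq => // <-.
by rewrite -{1}(submK le_Um) addmC mulrC mcoeffMX.
Qed.

Lemma mlead_eq p m :
  p@_m != 0 -> (forall m', (m < m')%O -> p@_m' = 0) -> mlead p = m.
Proof.
move=> pm gt_m; apply/le_anti/andP; split.
  rewrite leNgt; apply/negP => /gt_m/eqP.
  by rewrite mleadc_eq0 => /eqP p0; rewrite p0 mcoeff0 eqxx in pm.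
by apply: msupp_le_mlead; rewrite mcoeff_msupp.
Qed.

End Coefficients.

(** * Linear maps that are unitriangular on monomials *)

Section UnitriangularMap.
Context {k : nat} {R : comNzRingType}.
Implicit Types (p q : {mpoly R[k]}) (m : 'X_{1..k}).

Variable y : 'X_{1..k} -> {mpoly R[k]}.

Definition monlin p : {mpoly R[k]} := \sum_(m <- msupp p) p@_m *: y m.

(** A range of summation that does not depend on [p] makes linearity a termwise identity. *)
Lemma monlinE p d : (msize p <= d)%N ->
  monlin p = \sum_(m : 'X_{1..k < d}) p@_m *: y m.
Proof.
move=> le_pd; rewrite /monlin.
rewrite (big_mksub 'X_{1..k < d}) ?msupp_uniq //=; last first.
  by move=> m /msize_mdeg_lt /leq_trans; apply.
by rewrite big_rmcond //= => m /memN_msupp_eq0 ->; rewrite scale0r.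
Qed.

Lemma monlin_is_linear : linear monlin.
Proof.
move=> c p q; pose d := maxn (msize (c *: p + q)) (maxn (msize p) (msize q)).
rewrite !(@monlinE _ d) ?leq_max ?leqnn ?orbT // scaler_sumr -big_split /=.
by apply: eq_bigr => m _; rewrite mcoeffD mcoeffZ scalerDl scalerA.
Qed.

HB.instance Definition _ :=
  GRing.isLinear.Build R {mpoly R[k]} {mpoly R[k]} _ monlin monlin_is_linear.

Lemma monlinX m : monlin 'X_[m] = y m.
Proof. by rewrite /monlin msuppX big_seq1 mcoeffX eqxx scale1r. Qed.

Hypothesis mlead_y : forall m, mlead (y m) = m.
Hypothesis mleadc_y : forall m, (y m)@_m = 1.

(** Only the term of [mlead p] contributes: any other [m] in the support is smaller, and [y m] has
    no monomial above [m]. *)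
Lemma monlin_mleadc p : (monlin p)@_(mlead p) = mleadc p.
Proof.
have [->|nz_p] := eqVneq p 0; first by rewrite linear0 mleadc0.
rewrite /monlin raddf_sum /= (bigD1_seq (mlead p)) ?mlead_supp ?msupp_uniq //=.
rewrite mcoeffZ mleadc_y mulr1 big_seq_cond big1 ?addr0 // => m /andP[mp nm].
rewrite mcoeffZ (@mcoeff_gt_mlead _ _ (y m)) ?mulr0 // mlead_y lt_neqAle nm.
exact: msupp_le_mlead.
Qed.

Lemma monlin_inj p : monlin p = 0 -> p = 0.
Proof.
by move=> Tp0; apply/eqP; rewrite -mleadc_eq0 -monlin_mleadc Tp0 mcoeff0.
Qed.

Lemma monlin_surj p : exists q, p = monlin q.
Proof.
elim/mleadrect: p => p IHp.
have [->|nz_p] := eqVneq p 0; first by exists 0; rewrite linear0.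
pose r := p - mleadc p *: y (mlead p).
(* The zero remainder is treated apart: [mlead 0] is the zero exponent, which is not below [mlead p]
   when [p] is constant. *)
have [r0|nz_r] := eqVneq r 0.
  exists (mleadc p *: 'X_[mlead p]).
  by rewrite linearZ /= monlinX; apply/eqP; rewrite -subr_eq0 -/r r0.
have lt_r : (mlead r < mlead p)%O.
  rewrite lt_neqAle; apply/andP; split.
    apply: contraNneq nz_r => eq_rp; rewrite -mleadc_eq0 eq_rp.
    by rewrite mcoeffB mcoeffZ mleadc_y mulr1 subrr.
  apply: le_trans (mleadB_le _ _) _.
  by rewrite leUx lexx /= (le_trans (mleadZ_le _ _)) // mlead_y.
have [q rE] := IHp r lt_r.
exists (q + mleadc p *: 'X_[mlead p]).
by rewrite linearD linearZ /= monlinX -rE subrK.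
Qed.

End UnitriangularMap.

(** * Quotients by polynomials led by pure powers *)

Section PurePowerLeads.
Context {k : nat} {R : comNzRingType}.
Variables (D : 'I_k -> nat) (f : 'I_k -> {mpoly R[k]}).
Hypothesis D_gt0 : forall i, (0 < D i)%N.
Hypothesis mlead_f : forall i, mlead (f i) = (U_(i) *+ D i)%MM.
Hypothesis mleadc_f : forall i, mleadc (f i) = 1.
Implicit Types (m : 'X_{1..k}).

(** A substitute for ['X_[m]] in which as many factors [x_i^(D i)] as possible are traded for
    [f i]. *)
Definition divmon m : {mpoly R[k]} :=
  'X_[[multinom (m i %% D i)%N | i < k]] * \prod_(i < k) f i ^+ (m i %/ D i).

(** [R] may have zero divisors; leading monomials still multiply, because the leading coefficients
    are 1 and hence regular. *)
Let lreg_f i : GRing.lreg (mleadc (f i)).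
Proof. by rewrite mleadc_f; apply: lreg1. Qed.

Let mlead_fX i e : mlead (f i ^+ e) = (U_(i) *+ (D i * e))%MM.
Proof.
rewrite mleadX_proper // mlead_f; apply/mnmP => j.
by rewrite !mulmnE mulnA.
Qed.

Let mleadc_fX i e : mleadc (f i ^+ e) = 1.
Proof. by rewrite mleadcX_proper // mleadc_f expr1n. Qed.

Lemma mlead_divmon m : mlead (divmon m) = m.
Proof.
have lreg_fX i : GRing.lreg (mleadc (f i ^+ (m i %/ D i))).
  by rewrite mleadc_fX; apply: lreg1.
rewrite mleadM_proper; last first.
  by rewrite mleadXm mcoeffX eqxx mul1r mleadc_prod_proper // big1 ?oner_neq0.
rewrite mleadXm mlead_prod_proper //; apply/mnmP => j.
rewrite mnmDE mnmE mnm_sumE (bigD1 j) //= big1 ?addn0 => [|i ij].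
  by rewrite mlead_fX mulmnE mnm1E eqxx mul1n addnC mulnC -divn_eq.
by rewrite mlead_fX mulmnE mnm1E (negbTE ij).
Qed.

Lemma mleadc_divmon m : (divmon m)@_m = 1.
Proof.
have c1 : mleadc (\prod_(i < k) f i ^+ (m i %/ D i)) = 1.
  rewrite mleadc_prod_proper ?big1 // => i _ _.
  by rewrite mleadc_fX; apply: lreg1.
rewrite -{1}[m]mlead_divmon mleadcM_proper mleadXm mcoeffX eqxx mul1r c1 //.
exact: oner_neq0.
Qed.

Lemma divmonD m i : divmon (U_(i) *+ D i + m)%MM = f i * divmon m.
Proof.
rewrite /divmon mulrCA; congr (_ * _).
  congr 'X_[_]; apply/mnmP => j; rewrite !mnmE mulmnE mnm1E.
  by case: eqVneq => [->|_]; rewrite ?mul0n // mul1n modnDl.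
rewrite (bigD1 i) //= [in RHS](bigD1 i) //= mulrA -exprS; congr (_ * _).
  by rewrite mnmDE mulmnE mnm1E eqxx mul1n divnDl // divnn D_gt0.
by apply: eq_bigr => j /negbTE ji; rewrite mnmDE mulmnE mnm1E eq_sym ji mul0n.
Qed.

Lemma divmon_small m : (forall i, (m i < D i)%N) -> divmon m = 'X_[m].
Proof.
move=> lt_m; rewrite /divmon big1 ?mulr1 => [|i _]; last by rewrite divn_small.
by congr 'X_[_]; apply/mnmP => i; rewrite mnmE modn_small.
Qed.

(** By linearity from [divmonD]. Together with bijectivity, this identifies the ideal of the
    [x_i^(D i)] with that of the [f i]. *)
Lemma monlin_divmonM i (p : {mpoly R[k]}) :
  monlin divmon ('X_[U_(i) *+ D i] * p) = f i * monlin divmon p.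
Proof.
elim/mpolyind: p => [|c m p _ _ IHp]; first by rewrite mulr0 !linear0 mulr0.
rewrite mulrDr !linearD /= mulrDr IHp -scalerAr -mpolyXD !linearZ /= !monlinX.
by rewrite divmonD scalerAr.
Qed.

Let small m := [forall i, (m i < D i)%N].

Lemma divmon_ideal m : ~~ small m -> divmon m \in gen_ideal f.
Proof.
case/forallPn=> i; rewrite -leqNgt => le_Dm.
have -> : m = (U_(i) *+ D i + (m - U_(i) *+ D i))%MM.
  rewrite addmC submK //; apply/mnm_lepP => j; rewrite mulmnE mnm1E.
  by case: eqVneq => [<-|]; rewrite ?mul1n.
by rewrite divmonD mulrC; apply/gen_idealMl/mem_gen_ideal.
Qed.

(** Surjectivity lifts the cofactors of the [f i], and injectivity then writes [p] as a combination
    of the [x_i^(D i)], which has no small monomial. *)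
Lemma ideal_small_coeff (p : {mpoly R[k]}) :
  monlin divmon p \in gen_ideal f -> forall m, small m -> p@_m = 0.
Proof.
move=> /gen_idealP[c pE] m /forallP lt_m.
have /fin_all_exists[q qE] i : exists q, c i = monlin divmon q.
  exact: monlin_surj mlead_divmon mleadc_divmon _.
have /eqP : p - \sum_(i < k) 'X_[U_(i) *+ D i] * q i = 0.
  apply: (monlin_inj mlead_divmon mleadc_divmon).
  rewrite linearB /= pE [X in _ - X]linear_sum /= -sumrB big1 // => i _.
  by rewrite monlin_divmonM qE mulrC subrr.
rewrite subr_eq0 => /eqP ->; rewrite raddf_sum big1 //= => i _.
by rewrite (@mcoeffXM_not_le _ _ m _ _ i) // mulmnE mnm1E eqxx mul1n.
Qed.

(** Stated for any [g] generating the same ideal as [f], so that the quotient by the original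
    generators is never replaced by another one. *)
Theorem pure_power_leads_basis (g : 'I_k -> {mpoly R[k]}) :
  (forall i, g i \in gen_ideal f) -> (forall i, f i \in gen_ideal g) ->
  is_basis (fun al : {m | small m} => residue g 'X_[sval al]).
Proof.
move=> gf fg; have residue0 p : (residue g p = 0) <-> (p \in gen_ideal g).
  rewrite -[0](raddf0 (residue g)); split=> [/residue_eqP|pJ].
    by rewrite subr0.
  by apply/residue_eqP; rewrite subr0.
split=> [s c uniq_s | x].
  under eq_bigr do rewrite -linearZ.
  rewrite -raddf_sum /= => /residue0 /(gen_ideal_sub gf) pf al al_s.
  (* All exponents of [p] are small, so [monlin divmon] fixes [p]. *)
  pose p : {mpoly R[k]} := \sum_(i <- s) c i *: 'X_[sval i].
  have : p@_(sval al) = 0.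
    apply: ideal_small_coeff (svalP al); suff -> : monlin divmon p = p by [].
    rewrite linear_sum; apply: eq_bigr => be _ /=; rewrite linearZ /= monlinX.
    by rewrite divmon_small //; apply/forallP/(svalP be).
  rewrite raddf_sum (bigD1_seq al) //= mcoeffZ mcoeffX eqxx mulr1.
  rewrite big1 ?addr0 //.
  by move=> be /negbTE ne; rewrite mcoeffZ mcoeffX val_eqE ne mulr0.
have [p <-] := residue_surj x.
have [q ->] := monlin_surj mlead_divmon mleadc_divmon p.
(* The witness keeps the small exponents of [q]; the remaining terms of [monlin divmon q] lie in the
   ideal. *)
exists (pmap insub (msupp q)), (fun al => q@_(sval al)).
under [RHS]eq_bigr do rewrite -linearZ.
rewrite -raddf_sum; apply/eqP; rewrite -subr_eq0 -raddfB; apply/eqP/residue0.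
rewrite /monlin (bigID small) /= addrAC big_mkcond /=.
set S := (X in X + _); suff -> : S = 0.
  rewrite add0r; apply: rpred_sum => m /divmon_ideal mf.
  exact/gen_ideal_scale/(gen_ideal_sub fg).
rewrite {}/S; apply/eqP; rewrite subr_eq0; apply/eqP.
elim: (msupp q) => [|m s IHs]; rewrite ?big_nil //= big_cons IHs.
case: insubP => [al sm alE|/negbTE->] /=; last by rewrite add0r.
by rewrite big_cons sm alE divmon_small //; apply/forallP.
Qed.

End PurePowerLeads.

(** * Elimination of variables from the generators *)

Section Elimination.
Context {k : nat} {R : comNzRingType}.
Implicit Types (g : 'I_k -> {mpoly R[k]}) (m : 'X_{1..k}).

(** Extension by zero to all natural indices, which lets the recursion below run over [nat]. *)
Definition ext0 g (t : nat) : {mpoly R[k]} := \sum_(i < k | i == t :> nat) g i.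

Lemma ext0E g (i : 'I_k) : ext0 g i = g i.
Proof. by rewrite /ext0 (big_pred1 i) // => j; rewrite -val_eqE. Qed.

(* When g t is h_{d+t+1}, the entry at (j, t) with j <= t < k is h_{d+t+1}
   in the variables of 0-based index >= j. *)
Fixpoint elim_gens g (j t : nat) : {mpoly R[k]} :=
  if j is j'.+1 then
    elim_gens g j' t - ext0 (fun i => 'X_i) j' * elim_gens g j' t.-1
  else ext0 g t.

Lemma elim_gens_ideal g j t : (t < k)%N -> elim_gens g j t \in gen_ideal g.
Proof.
elim: j t => [|j IHj] t lt_tk /=.
  by rewrite -[t]/(val (Ordinal lt_tk)) ext0E mem_gen_ideal.
by rewrite rpredB ?gen_idealMl ?IHj ?(leq_ltn_trans (leq_pred t)).
Qed.

(** Solved backwards, the recursion expresses entry [(j, t)] through [(j+1, t)] and [(j, t-1)], both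
    closer to the diagonal; hence the induction on [t - j]. *)
Lemma elim_gens_diag_ideal g (f := fun i : 'I_k => elim_gens g i i) j t :
  (j <= t < k)%N -> elim_gens g j t \in gen_ideal f.
Proof.
move: {2}(t - j)%N (leqnn (t - j)) => e.
elim: e j t => [|e IHe] j t le_e /andP[le_jt lt_tk]; move: le_jt.
  rewrite leqn0 subn_eq0 in le_e; move=> le_jt.
  have <- : t = j by apply/anti_leq/andP.
  exact: (mem_gen_ideal f (Ordinal lt_tk)).
rewrite leq_eqVlt => /predU1P[->|lt_jt].
  exact: (mem_gen_ideal f (Ordinal lt_tk)).
have -> : elim_gens g j t
  = elim_gens g j.+1 t + ext0 (fun i => 'X_i) j * elim_gens g j t.-1.
  by rewrite /= subrK.
case: t => // t in le_e lt_tk lt_jt *.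
rewrite subSn // ltnS in le_e.
rewrite rpredD ?gen_idealMl ?IHe ?lt_jt ?lt_tk //=.
by rewrite -ltnS lt_jt ltnW.
Qed.

Lemma mcoeff_elim_gens g d j t m :
    (forall (i : 'I_k) m, (d + i < mdeg m)%N ->
      (g i)@_m = (mdeg m == (d + i.+1)%N)%:R) ->
    (j <= t < k)%N -> (d + t < mdeg m)%N ->
  (elim_gens g j t)@_m
    = ((mdeg m == (d + t.+1)%N)
        && [forall i : 'I_k, (i < j)%N ==> (m i == 0%N)])%:R.
Proof.
move=> gE; elim: j t m => [|j IHj] t m /andP[le_jt lt_tk] lt_m.
  rewrite /= -[t]/(val (Ordinal lt_tk)) ext0E gE //.
  by rewrite (introT forallP) ?andbT.
have lt_jk := ltn_trans le_jt lt_tk; pose o := Ordinal lt_jk.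
rewrite /= -[j]/(val o) ext0E mcoeffB mcoeffXUM IHj ?(ltnW le_jt) //.
have -> : [forall i : 'I_k, (i < (val o).+1)%N ==> (m i == 0%N)]
  = [forall i : 'I_k, (i < j)%N ==> (m i == 0%N)] && (m o == 0%N).
  apply/forallP/andP => [z|[/forallP z mo] i].
    split; last by have := z o; rewrite ltnSn.
    apply/forallP => i; apply/implyP => lt_ij.
    exact/(implyP (z i))/ltnW.
  rewrite ltnS leq_eqVlt; apply/implyP => /predU1P[eq_ij|]; last exact/implyP/z.
  by have -> : i = o by apply/val_inj.
(* If [x_j] does not divide the monomial, the subtracted product contributes nothing; if it does,
   the two contributions cancel. *)
case: posnP => [m0|m_gt0] /=; first by rewrite subr0 andbT.
case: t => // t in le_jt lt_tk lt_m *.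
have degm : mdeg m = (mdeg (m - U_(o))).+1.
  have le_Um : (U_(o) <= m)%MM.
    by apply/mnm_lepP => i; rewrite mnm1E; case: eqVneq => // <-.
  by rewrite -{1}(submK le_Um) mdegD mdeg1 addn1.
rewrite !andbF /= IHj; first last.
- by rewrite degm addnS ltnS in lt_m.
- by rewrite -ltnS le_jt ltnW.
rewrite degm addnS eqSS.
suff -> : [forall i : 'I_k, (i < j)%N ==> ((m - U_(o))%MM i == 0%N)]
  = [forall i : 'I_k, (i < j)%N ==> (m i == 0%N)] by rewrite subrr.
apply: eq_forallb => i; rewrite mnmBE mnm1E -val_eqE /=.
by case: (ltnP i j) => // lt_ij; rewrite (gtn_eqF lt_ij) subn0.
Qed.

(** In degrees above [d + i], [p] is the complete homogeneous polynomial of degree [d+i+1] in the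
    variables of index at least [i]; its largest monomial is the pure power of [x_i]. *)
Lemma mlead_elim_gens_diag g d (i : 'I_k) (p := elim_gens g i i) :
    (forall (i : 'I_k) m, (d + i < mdeg m)%N ->
      (g i)@_m = (mdeg m == (d + i.+1)%N)%:R) ->
  mlead p = (U_(i) *+ (d + i.+1))%MM /\ mleadc p = 1.
Proof.
move=> gE; set M := (U_(i) *+ (d + i.+1))%MM.
have degM : mdeg M = (d + i.+1)%N by rewrite mdegMn mdeg1 mul1n.
have pM : p@_M = 1.
  rewrite (mcoeff_elim_gens gE) ?leqnn ?ltn_ord ?degM ?addnS // eqxx.
  rewrite (introT forallP) // => j; apply/implyP => lt_ji.
  by rewrite mulmnE mnm1E -val_eqE (gtn_eqF lt_ji).
suff leadM : mlead p = M by rewrite leadM.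
apply: mlead_eq => [|m lt_Mm]; first by rewrite pM oner_neq0.
have le_deg : (d + i.+1 <= mdeg m)%N.
  by rewrite -degM; apply/lemc_mdeg/ltW.
rewrite (mcoeff_elim_gens gE) ?leqnn ?ltn_ord //; last by rewrite -addnS.
have [degm|//] := eqVneq; case: forallP => //= z.
(* Let [j] be the first index where [m] exceeds [M]. If [j < i], then [m j] vanishes; if [j > i],
   then [m i] already uses up the whole degree; if [j = i], then [m i] exceeds it. *)
have /ltmcP := lt_Mm; rewrite degM degm => /(_ erefl)[j Mm lt_j].
have [lt_ji|lt_ij|/val_inj eq_ij] := ltngtP j i.
- by move: lt_j; rewrite (eqP (implyP (z j) lt_ji)).
- have : (m i + m j <= mdeg m)%N.
    rewrite mdegE (bigD1 i) //= (bigD1 j) -?val_eqE ?(gtn_eqF lt_ij) //=.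
    by rewrite addnA leq_addr.
  rewrite -(Mm _ lt_ij) degm mulmnE mnm1E eqxx mul1n -leq_subRL // subnn leqn0.
  by move/eqP => mj0; rewrite mj0 in lt_j.
- have : (m j <= mdeg m)%N by rewrite mdegE (bigD1 j) //= leq_addr.
  by rewrite degm leqNgt (leq_trans _ lt_j) // mulmnE eq_ij mnm1E eqxx mul1n.
Qed.

End Elimination.

(** * Complete homogeneous polynomials and the quotient basis *)

Lemma mcoeff_hsym (R : comNzRingType) k d (m : 'X_{1..k}) :
  (hsym R k d)@_m = (mdeg m == d)%:R.
Proof.
have -> : hsym R k d
  = \sum_(al : 'X_{1..k < d.+1}) (mdeg al == d)%:R *: 'X_[al].
  rewrite /hsym big_mkcond /=; apply: eq_bigr => al _.
  by case: eqP => _; rewrite ?scale1r ?scale0r.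
have [lt_md|le_dm] := ltnP (mdeg m) d.+1.
  by rewrite (mcoeff_mpoly (fun m => (mdeg m == d)%:R)).
rewrite (gtn_eqF le_dm) raddf_sum big1 //= => al _.
rewrite mcoeffZ mcoeffX.
case: (eqVneq (val al) m) => [eq_m|]; last by rewrite mulr0.
by have := leq_trans (bmdeg al) le_dm; rewrite eq_m ltnn.
Qed.

(* [msize p <= d] says that p has total degree < d (msize 0 = 0). *)
Theorem theorem2p2 (R : comNzRingType) (k n : nat) (le_kn : (k <= n)%N)
    (a : 'I_k -> {mpoly R[k]})
    (deg_a : forall i : 'I_k, (msize (a i) <= n - k + i.+1)%N) :
  let J_gens := fun i : 'I_k => hsym R k (n - k + i.+1) - a i in
  is_basis (fun al : box k n => residue J_gens 'X_[sval al]).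
Proof.
move=> g; pose f i := elim_gens g i i.
(* The degree bound on [a i] removes it from these coefficients, leaving those of the complete
   homogeneous polynomial. *)
have gE (i : 'I_k) m : (n - k + i < mdeg m)%N ->
    (g i)@_m = (mdeg m == (n - k + i.+1)%N)%:R.
  rewrite -addnS => le_m; rewrite mcoeffB mcoeff_hsym.
  by rewrite (memN_msupp_eq0 (msize_mdeg_ge (leq_trans (deg_a i) le_m))) subr0.
apply: (@pure_power_leads_basis k R (fun i => n - k + i.+1)%N f).
- by move=> i; rewrite addnS.
- by move=> i; case: (mlead_elim_gens_diag i gE).
- by move=> i; case: (mlead_elim_gens_diag i gE).
(* [g i] is the entry [(0, i)] of the elimination table. *)
- move=> i; rewrite -(ext0E g i).
  by apply: (@elim_gens_diag_ideal k R g 0 i); rewrite ltn_ord.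
- by move=> i; apply: elim_gens_ideal.
Qed.
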